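(* Let $R$ be a finite chain ring with residue field of cardinality $p^r$ ($p$ prime) and with maximal ideal of nilpotency index $s$, and let $0<k<n$ be integers. The number of $n$-equivalence classes on $B_k$ is $$|B_k/\sim_n| = p^{r(s-1)}(p^r-1)\sum_{\substack{0\le l\le \omega(k)\\ u\mid \gcd(n,k,p^r-1)}}\#\mathrm{ord}(l,u),$$ where the sum runs over integers $l$ with $0\le l\le\omega(k)$ and positive divisors $u$ of $\gcd(n,k,p^r-1)$, and $\omega(k)=\min\{v_p(\gcd(n,k)),m_J\}$.
   Context: A finite chain ring $R$ is a finite commutative local ring with identity whose ideals are linearly ordered by inclusion; $R^\times$ is its group of units, of order $p^{r(s-1)}(p^r-1)$. For $0<k<n$, $B_k=\{b_1x^k+b_0\mid b_1,b_0\in R^\times\}\subset R[x]$. Two elements $a(x),b(x)\in B_k$ are $n$-equivalent, $a(x)\sim_n b(x)$, if there exists $\alpha\in R^\times$ such that $f(x)\mapsto f(\alpha x)$ is a (well-defined) $R$-algebra isomorphism $R[x]/\langle x^n-a(x)\rangle\to R[x]/\langle x^n-b(x)\rangle$; this is an equivalence relation. Write $R^\times\simeq\left[\bigoplus_{j=1}^J\mathbb Z_{p^{m_j}}\right]\oplus\mathbb Z_{p^r-1}$ with $J\ge1$, integers $0\le m_1\le m_2\le\dots\le m_J$ and $\sum_{j=1}^Jm_j=r(s-1)$. $v_p$ denotes the $p$-adic valuation and $\Phi$ Euler's totient function. For an integer $0\le l\le m_J$ put $l_j=\min\{l,m_j\}$ for $1\le j\le J$, and let $\varepsilon(l)$ be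 the smallest index in $\{1,\dots,J\}$ with $l_{\varepsilon(l)}=l$. For a positive divisor $u$ of $p^r-1$, $\#\mathrm{ord}(l,u)$ (the number of elements of $R^\times$ of order $p^lu$) is given by $\#\mathrm{ord}(0,u)=\Phi(u)$ and, for $l>0$, $$\#\mathrm{ord}(l,u)=\sum_{(t_1,\dots,t_J)\in T_l}\Phi(u)\prod_{j=1}^J\Phi(p^{t_j})-\sum_{(t_1,\dots,t_J)\in T'_l}\Phi(u)\prod_{j=1}^J\Phi(p^{t_j}),$$ where $T_l$ is the set of integer tuples with $0\le t_i\le l_i$ for all $1\le i\le J$, and $T'_l$ is the set of integer tuples with $0\le t_i\le l_i$ for $1\le i\le\varepsilon(l)-1$ and $0\le t_i\le l-1$ for $\varepsilon(l)\le i\le J$. *)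

(* Defs.v *)
From HB Require Import structures.
From mathcomp Require Import all_boot all_order all_algebra all_fingroup all_solvable.
From mathcomp Require Import finalg qpoly.
From mathcomp Require Import boolp classical_sets functions cardinality.

Set Implicit Arguments.
Unset Strict Implicit.
Unset Printing Implicit Defensive.

Import GRing.Theory.
Local Open Scope ring_scope.

Section ChainRings.
Variable R : finComUnitRingType.
Implicit Types I J M : {set R}.

Definition is_ideal I : bool :=
  (0 \in I) && [forall a : R, forall u in I, forall v in I, a * u + v \in I].

Definition is_maximal_ideal M : Prop :=
  [/\ is_ideal M, M != [set: R]%SET &
      forall I, is_ideal I -> M \subset I -> I = M \/ I = [set: R]%SET].

Definition is_finite_chain_ring : Prop :=
  (exists! M, is_maximal_ideal M) /\
  (forall I J, is_ideal I -> is_ideal J -> I \subset J \/ J \subset I).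

(* The product ideal, as the least ideal containing all products of an element
   of I and an element of J. *)
Definition ideal_mul I J : {set R} :=
  (\bigcap_(K : {set R} | is_ideal K &&
     ([set (x * y)%R | x in I, y in J]%SET \subset K)) K)%SET.

Definition ideal_exp M (t : nat) : {set R} := iter t (ideal_mul M) [set: R]%SET.

Definition nilpotency_index M (s : nat) : Prop :=
  ideal_exp M s = [set 0]%SET /\
  forall t : nat, (t < s)%N -> ideal_exp M t <> [set 0]%SET.

(* The index of M in the additive group of R. *)
Definition residue_card M : nat := #|[set: R]%SET : M|%g.

(* 'Z_d is Z/2 when d <= 1, whereas Zp d is its trivial subgroup when d <= 1, so
   that Zp d is cyclic of order d for every d > 0. *)
Definition units_decomposition (p r J : nat) (m : J.-tuple nat) : Prop :=
  [set: {unit R}]%SET \isog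
    finset.setX (setXn (fun j : 'I_J => Zp (p ^ tnth m j))) (Zp (p ^ r - 1)).

End ChainRings.

Section Equivalence.
Variable R : finComUnitRingType.
Local Open Scope classical_set_scope.

Definition Bset (k : nat) : set {poly R} :=
  [set a | exists b1 b0 : R,
     [/\ b1 \is a GRing.unit, b0 \is a GRing.unit &
         a = b1 *: 'X^k + b0%:P]].

(* {poly %/ h} is the quotient of R[x] by h for monic h of positive degree (it
   is R[x]/(x) for other h); below, h = x^n - a(x) with a in Bset k and
   0 < k < n, which is monic of degree n. *)
Definition n_equiv (n : nat) (a b : {poly R}) : Prop :=
  exists2 alpha : R, alpha \is a GRing.unit &
  exists2 phi : {lrmorphism {poly %/ ('X^n - a)} -> {poly %/ ('X^n - b)}},
    bijective phi &
    forall f : {poly R},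
      phi (in_qpoly ('X^n - a) f) = in_qpoly ('X^n - b) (f \Po (alpha *: 'X)).

Definition n_class (n k : nat) (a : {poly R}) : set {poly R} :=
  [set b | Bset k b /\ n_equiv n a b].

Definition n_classes (n k : nat) : set (set {poly R}) :=
  [set n_class n k a | a in Bset k].

End Equivalence.

Section Counting.
Variables (p J : nat) (m : J.-tuple nat).
Local Open Scope nat_scope.

Definition lmin (l : nat) (j : 'I_J) : nat := minn l (tnth m j).

(* Indices start at 0 here: this is one less than the smallest j in {1, ..., J}
   with min(l, m_j) = l. *)
Definition epsilon (l : nat) : nat := find (fun mj : nat => minn l mj == l) m.

(* All the tuples have entries at most l, hence the type 'I_l.+1. *)
Definition Tset (l : nat) : {set {ffun 'I_J -> 'I_l.+1}} :=
  [set t : {ffun 'I_J -> 'I_l.+1} | [forall i : 'I_J, t i <= lmin l i]]%SET.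

Definition Tset' (l : nat) : {set {ffun 'I_J -> 'I_l.+1}} :=
  [set t : {ffun 'I_J -> 'I_l.+1} |
     [forall i : 'I_J, if i < epsilon l then t i <= lmin l i else t i <= l - 1]]%SET.

(* The second sum never exceeds the first: Tset' l is included in Tset l for
   l <= m_J, since m is sorted. *)
Definition num_ord (l u : nat) : nat :=
  if l == 0 then totient u else
  \sum_(t in Tset l) totient u * \prod_(j < J) totient (p ^ t j) -
  \sum_(t in Tset' l) totient u * \prod_(j < J) totient (p ^ t j).

(* last 0 m is m_J as soon as J > 0. *)
Definition omega (n k : nat) : nat := minn (logn p (gcdn n k)) (last 0 m).

End Counting.

(* Main.v *)
Require Import Defs.
From HB Require Import structures.
From mathcomp Require Import all_boot all_order all_algebra all_fingroup all_solvable.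
From mathcomp Require Import finalg qpoly zify.
From mathcomp Require Import boolp classical_sets functions cardinality.

Set Implicit Arguments.
Unset Strict Implicit.
Unset Printing Implicit Defensive.

Import GRing.Theory.

(** The map x |-> alpha x is well defined from R[x]/(x^n - a) to R[x]/(x^n - b)
    exactly when alpha^n (x^n - b(x)) = alpha^n x^n - a(alpha x), that is when
    a1 = alpha^(n-k) b1 and a0 = alpha^n b0. Identifying B_k with U x U, where
    U is the group of units, the n-equivalence classes are thus the cosets of
    the image of the morphism alpha |-> (alpha^(n-k), alpha^n), whose kernel
    consists of the alpha with alpha^gcd(n,k) = 1; so there are |U| |kernel|
    classes. The structure of U gives the size of the kernel, and the sum over
    l telescopes since #ord(l,u) = Phi(u) (A_l - A_(l-1)), where A_l counts
    the elements of the p-part of U killed by p^l. *)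

(** * Sums of Euler's totient function *)

Section Totients.
Local Open Scope nat_scope.

Lemma sum_totient_divisors n : 0 < n -> \sum_(d <- divisors n) totient d = n.
Proof.
move=> n_gt0; rewrite -[RHS]sum_totient_dvd -(big_mkord (dvdn^~ n)).
rewrite -[RHS]big_filter; apply: perm_big; apply: uniq_perm => [||d].
- exact: divisors_uniq.
- exact/filter_uniq/iota_uniq.
rewrite -dvdn_divisors // mem_filter mem_index_iota ltnS /=.
by case: (boolP (d %| n)) => // /(dvdn_leq n_gt0) ->.
Qed.

Lemma sum_totient_exp p l : prime p -> \sum_(t < l.+1) totient (p ^ t) = p ^ l.
Proof.
move=> p_prime; elim: l => [|l IHl]; first by rewrite big_ord1.
rewrite big_ord_recr /= IHl totient_pfactor //= -mulSn prednK ?prime_gt0 //.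
by rewrite expnS.
Qed.

(** Distributivity turns the sum over a box of tuples into a product of sums, each equal to
    [p ^ b i]. [L] is only a common bound that keeps the type of tuples finite. *)
Lemma sum_prod_totient_exp p J L (b : 'I_J -> nat) :
    prime p -> (forall i, b i <= L) ->
  \sum_(t : {ffun 'I_J -> 'I_L.+1} | [forall i, t i <= b i])
    \prod_(i < J) totient (p ^ t i) = \prod_(i < J) p ^ b i.
Proof.
move=> p_prime b_le; transitivity (\prod_(i < J) \sum_(t < L.+1 | t <= b i)
    totient (p ^ t)).
  rewrite bigA_distr_big_dep; apply: eq_bigl => t.
  by apply/forallP/familyP.
apply: eq_bigr => i _; rewrite -sum_totient_exp //.
by rewrite (big_ord_widen L.+1 (fun t => totient (p ^ t))) ?ltnS.
Qed.

End Totients.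

(** * The numbers #ord(l,u) as differences, and their sum over l *)

Section NumOrd.
Variables (p J : nat) (m : J.-tuple nat).
Hypotheses (p_prime : prime p) (m_sorted : sorted leq m).
Local Open Scope nat_scope.

(* The number of elements killed by p ^ l in the direct sum of the Z/p^m_j. *)
Definition num_exp (l : nat) : nat := \prod_(j < J) p ^ minn l (tnth m j).

Lemma leq_num_exp l1 l2 : l1 <= l2 -> num_exp l1 <= num_exp l2.
Proof.
move=> le_l; apply: leq_prod => j _; rewrite leq_exp2l ?prime_gt1 //.
by rewrite leq_min geq_minr geq_min le_l.
Qed.

(* Hence Tset' l is the box of the tuples bounded by min(l - 1, m_j). *)
Lemma epsilon_bound l (i : 'I_J) : 0 < l -> l <= last 0 m ->
  (if i < epsilon m l then lmin m l i else l - 1) = minn (l - 1) (tnth m i).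
Proof.
move=> l_gt0 l_le; rewrite /lmin /epsilon (tnth_nth 0).
set P := fun mj => minn l mj == l.
(* Before index [epsilon m l], m_i < l and both sides are m_i; from that index on, sortedness gives
   l <= m_i and both sides are l - 1. *)
case: ltnP => [/(before_find 0) | le_i].
  move/negbT; rewrite /P -/(l <= _) => /eqP; lia.
have im : i < size m by rewrite size_tuple.
have has_m : has P m by rewrite has_find (leq_ltn_trans le_i).
have /eqP := nth_find 0 has_m.
have := sorted_leq_nth leq_trans leqnn 0 m_sorted (find P m) i.
rewrite !inE im -has_find has_m le_i => /(_ isT isT isT); lia.
Qed.

Lemma num_ordE l u : l <= last 0 m ->
  num_ord p m l u =
    totient u * (if l == 0 then 1 else num_exp l - num_exp l.-1).
Proof.
rewrite /num_ord; case: l => [|l] l_le /=; first by rewrite muln1.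
rewrite -!big_distrr -mulnBr /=; congr (_ * (_ - _)).
  rewrite -[RHS](sum_prod_totient_exp p_prime (L := l.+1)) => [|i].
    by apply: eq_bigl => t; rewrite inE.
  exact: geq_minl.
rewrite -[RHS](sum_prod_totient_exp p_prime (L := l.+1)) => [|i]; last lia.
apply: eq_bigl => t; rewrite inE; apply: eq_forallb => i.
rewrite -[X in minn X _](subn1 l.+1) -epsilon_bound //.
by case: ifP.
Qed.

Lemma sum_num_ord w u : w <= last 0 m ->
  \sum_(0 <= l < w.+1) num_ord p m l u = totient u * num_exp w.
Proof.
elim: w => [|w IHw] w_le.
  by rewrite big_nat1 num_ordE //= /num_exp big1 // => j _; rewrite min0n.
(* The truncated difference is exact because [num_exp] is nondecreasing. *)
rewrite big_nat_recr //= IHw 1?ltnW // num_ordE //= -mulnDr subnKC //.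
exact: leq_num_exp.
Qed.

(** No m_j exceeds m_J, so the cap m_J in [omega] leaves every min(l, m_j) unchanged. *)
Lemma num_exp_last l : num_exp (minn l (last 0 m)) = num_exp l.
Proof.
apply: eq_bigr => j _; rewrite -minnA; congr (p ^ minn _ _).
apply/minn_idPr; rewrite (tnth_nth 0) -nth_last.
have jm : j < size m by rewrite size_tuple.
apply: (sorted_leq_nth leq_trans leqnn) => //; rewrite ?inE; lia.
Qed.

End NumOrd.

(** * Solutions of x^d = 1 in cyclic groups and direct products *)

Section Ldiv.
Local Open Scope group_scope.

(** The solutions form the kernel of y |-> y^d, whose image is generated by x^d, of order [#[x] %/
    gcdn #[x] d]; Lagrange concludes. *)
Lemma card_Ldiv_cyclic (gT : finGroupType) (G : {group gT}) d :
  cyclic G -> #|'Ldiv_d(G)| = gcdn #|G| d.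
Proof.
case/cyclicP=> x ->; pose f := cyclem_morphism x d.
have -> : 'Ldiv_d(<[x]>) = 'ker f by apply/setP=> y; rewrite !inE.
have := card_morphim f <[x]>.
rewrite morphim_cycle ?cycle_id //= finset.setIid -[#|<[_]>|]/#[x ^+ d] orderXgcd.
move=> index_ker; have := Lagrange (subsetIl _ _ : 'ker f \subset <[x]>).
rewrite -index_ker -[#|<[x]>|]/#[x] -[RHS](divnK (dvdn_gcdl #[x] d)) mulnC.
move/eqP; rewrite eqn_pmul2l; first by move/eqP.
by rewrite divn_gt0 ?gcdn_gt0 ?order_gt0 // dvdn_leq ?dvdn_gcdl ?order_gt0.
Qed.

Lemma card_Ldiv_isog (aT rT : finGroupType) (G : {group aT}) (H : {group rT}) d :
  G \isog H -> #|'Ldiv_d(G)| = #|'Ldiv_d(H)|.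
Proof.
by case/isogP=> f injf <-; rewrite -injm_Ldiv // card_injm ?subsetIl.
Qed.

Lemma Ldiv_setX (aT rT : finGroupType) (A : {set aT}) (B : {set rT}) d :
  'Ldiv_d(finset.setX A B) = finset.setX 'Ldiv_d(A) 'Ldiv_d(B).
Proof.
have expg_pair (x : aT) (y : rT) : (x, y) ^+ d = (x ^+ d, y ^+ d).
  by elim: d => // d IHd; rewrite !expgS IHd.
apply/setP=> [[x y]]; rewrite !inE /= expg_pair.
by rewrite -[_ == 1]/((_ == 1) && (_ == 1)) andbACA.
Qed.

Lemma Ldiv_setXn (I : finType) (gT : I -> finGroupType)
    (A : forall i, {set gT i}) d :
  'Ldiv_d(setXn A) = setXn (fun i => 'Ldiv_d(A i)).
Proof.
have expg_ffun (x : {dffun forall i, gT i}) i : (x ^+ d) i = x i ^+ d.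
  by elim: d => [|d IHd]; rewrite ?oneg_ffun // !expgS mulg_ffun IHd.
apply/setP=> x; apply/LdivP/setXnP => [[/setXnP xA xd] i|xA].
  by apply/LdivP; rewrite xA -expg_ffun xd oneg_ffun.
split; first by apply/setXnP => i; have /LdivP[] := xA i.
apply/ffunP => i; rewrite oneg_ffun expg_ffun.
by have /LdivP[] := xA i.
Qed.

Lemma cyclic_Zp c : cyclic (Zp c).
Proof.
rewrite /Zp; case: ifP => _; last exact: cyclic1.
by rewrite Zp_cycle cycle_cyclic.
Qed.

End Ldiv.

(** * Gcds with prime powers, and cardinals of images *)

Section Cardinalities.
Local Open Scope nat_scope.

Lemma gcdn_pexp p e d : prime p -> 0 < d ->
  gcdn (p ^ e) d = p ^ minn (logn p d) e.
Proof.
move=> p_prime d_gt0; apply/eqP; rewrite eqn_dvd; apply/andP; split.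
  have /(dvdn_pfactor _ _ p_prime)[f le_fe gcdE] := dvdn_gcdl (p ^ e) d.
  rewrite gcdE dvdn_Pexp2l ?prime_gt1 // leq_min le_fe andbT.
  by rewrite -pfactor_dvdn // -gcdE dvdn_gcdr.
by rewrite dvdn_gcd dvdn_exp2l ?geq_minr // pfactor_dvdn // geq_minl.
Qed.

(** Bridge from cardinals of finite sets to those of classical sets: enumerating [A] makes the image
    that of an injection from the ordinals below [#|A|]. *)
Lemma card_eq_image_finset (T : finType) (S : Type) (A : {set T}) (g : T -> S) :
  injective g -> (image [set` A] g #= `I_#|A|)%card.
Proof.
move=> g_inj; rewrite (card_eqr card_II).
have -> : image [set` A] g = image setT (g \o @enum_val T (mem A)).
  apply/seteqP; split=> [_ [x xA <-] | _ [i _ <-]] /=.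
    by exists (enum_rank_in xA x) => //=; rewrite enum_rankK_in.
  by exists (enum_val i) => //=; exact: enum_valP.
by apply: inj_card_eq => i j _ _ /g_inj /enum_val_inj.
Qed.

End Cardinalities.

(** * Torsion and order of the unit group *)

Section UnitDecomposition.
Variables (R : finComUnitRingType) (p r J : nat) (m : J.-tuple nat).
Hypotheses (p_prime : prime p) (r_gt0 : (0 < r)%N).
Hypothesis R_units : units_decomposition R p r m.
Local Open Scope nat_scope.

Let q_gt0 : 0 < p ^ r - 1.
Proof. by rewrite subn_gt0 -(exp1n r) ltn_exp2r // prime_gt1. Qed.

(** Torsion is computed factor by factor: a cyclic factor of order c contributes gcd(c, d), a power
    of p when c = p^m_j. *)
Lemma card_Ldiv_units d : 0 < d ->
  #|('Ldiv_d([set: {unit R}]%SET))%g| = num_exp p m (logn p d) * gcdn (p ^ r - 1) d.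
Proof.
move=> d_gt0; rewrite (card_Ldiv_isog _ R_units) Ldiv_setX cardsX Ldiv_setXn.
rewrite cardsXn card_Ldiv_cyclic ?cyclic_Zp ?card_Zp //; congr (_ * _).
apply: eq_bigr => j _; rewrite card_Ldiv_cyclic ?cyclic_Zp ?card_Zp ?gcdn_pexp //.
by rewrite expn_gt0 prime_gt0.
Qed.

Lemma card_units :
  #|[set: {unit R}]%SET| = p ^ (\sum_(j < J) tnth m j) * (p ^ r - 1).
Proof.
rewrite (card_isog R_units) cardsX cardsXn card_Zp // expn_sum.
by congr (_ * _); apply: eq_bigr => j _; rewrite card_Zp // expn_gt0 prime_gt0.
Qed.

End UnitDecomposition.

(** This excludes r = 0. If all cosets coincided, any x, lying in M + x because 0 is in M, would lie
    in M. As [M] is a bare set, the argument works directly on cosets. *)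
Lemma residue_card_gt1 (R : finComUnitRingType) (M : {set R}) :
  is_maximal_ideal M -> (1 < residue_card M)%N.
Proof.
case=> /andP[M0 _] /eqP M_neqT _; rewrite ltn_neqAle eq_sym; apply/andP; split.
  apply/eqP=> /eqP /cards1P[C rcosetsE]; apply: M_neqT; apply/setP=> x.
  have rcoset_eq y : (M :* y)%g = C.
    have : (M :* y)%g \in rcosets M [set: R]%SET.
      by apply/rcosetsP; exists y; rewrite ?inE.
    by rewrite rcosetsE inE => /eqP.
  by rewrite inE -[M]rcoset1 rcoset_eq -(rcoset_eq x) mem_rcoset mulgV.
by apply/card_gt0P; exists (M :* 1)%g; apply/rcosetsP; exists 1%g; rewrite ?inE.
Qed.

(** * The substitution x |-> alpha x between quotients of R[x] *)

Section Substitution.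
Variables (R : comNzRingType) (g h : {poly R}) (alpha : R).
Local Open Scope ring_scope.

Lemma in_qpoly_mk_monic : in_qpoly g (mk_monic g) = 0.
Proof. by apply: val_inj; rewrite /= Pdiv.RingMonic.rmodpp ?monic_mk_monic. Qed.

Lemma in_qpolyK (q : {poly %/ g}) : in_qpoly g q = q.
Proof. by apply: val_inj; apply: in_qpoly_small; exact: size_mk_monic. Qed.

Definition qpoly_subst (q : {poly %/ g}) : {poly %/ h} :=
  in_qpoly h ((q : {poly R}) \Po (alpha *: 'X)).

Hypothesis subst_modulus :
  in_qpoly h (mk_monic g \Po (alpha *: 'X)) = 0.

(** Independence of the representative: after Euclidean division by [mk_monic g], [subst_modulus]
    kills the multiple of the modulus. *)
Lemma qpoly_subst_in f :
  qpoly_subst (in_qpoly g f) = in_qpoly h (f \Po (alpha *: 'X)).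
Proof.
rewrite [f in RHS](Pdiv.RingMonic.rdivp_eq (monic_mk_monic g)).
by rewrite comp_polyD comp_polyM in_qpolyD in_qpolyM subst_modulus mulr0 add0r.
Qed.

Lemma qpoly_subst_is_linear : linear qpoly_subst.
Proof.
by move=> a q1 q2; rewrite /qpoly_subst -in_qpolyZ -in_qpolyD comp_polyD comp_polyZ.
Qed.

Lemma qpoly_subst_is_monoid_morphism : monoid_morphism qpoly_subst.
Proof.
split=> [|q1 q2]; first by rewrite -in_qpoly1 qpoly_subst_in comp_polyC in_qpoly1.
rewrite -[q1]in_qpolyK -[q2]in_qpolyK -in_qpolyM !qpoly_subst_in.
by rewrite comp_polyM in_qpolyM.
Qed.

Lemma qpoly_subst_lrmorphism :
  exists phi : {lrmorphism {poly %/ g} -> {poly %/ h}}, phi =1 qpoly_subst.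
Proof.
pose lin := GRing.isLinear.Build R {poly %/ g} {poly %/ h} *:%R qpoly_subst
  qpoly_subst_is_linear.
pose mon := GRing.isMonoidMorphism.Build _ _ qpoly_subst
  qpoly_subst_is_monoid_morphism.
pose phi : {lrmorphism {poly %/ g} -> {poly %/ h}} := HB.pack qpoly_subst lin mon.
by exists phi.
Qed.

End Substitution.

(** * The n-equivalence classes as cosets in U x U *)

Section Classes.
Variables (R : finComUnitRingType) (n k : nat).
Hypotheses (k_gt0 : (0 < k)%N) (k_lt_n : (k < n)%N).
Local Notation U := {unit R}.
Implicit Types u v : U * U.

Section Polynomials.
Local Open Scope ring_scope.

Definition unit_binomial u : {poly R} := val u.1 *: 'X^k + (val u.2)%:P.

Lemma coef_unit_binomial u i :
  (unit_binomial u)`_i = val u.1 * (i == k)%:R + (if i == 0%N then val u.2 else 0).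
Proof. by rewrite coefD coefZ coefXn coefC. Qed.

Lemma unit_binomial_inj : injective unit_binomial.
Proof.
move=> [u1 u2] [v1 v2] /polyP eq_uv; congr pair; apply: val_inj.
  have := eq_uv k; rewrite !coef_unit_binomial eqxx !mulr1.
  by rewrite eqn0Ngt k_gt0 !addr0.
have := eq_uv 0%N; rewrite !coef_unit_binomial eqxx eq_sym eqn0Ngt k_gt0 /=.
by rewrite !mulr0 !add0r.
Qed.

Lemma size_unit_binomial u : (size (unit_binomial u) <= n)%N.
Proof.
apply: leq_trans (size_polyD _ _) _; rewrite geq_max.
rewrite (leq_trans (size_scale_leq _ _)) ?size_polyXn //=.
by rewrite (leq_trans (size_polyC_leq1 _)) // (leq_trans k_gt0) // ltnW.
Qed.

Lemma size_modulus u : size ('X^n - unit_binomial u) = n.+1.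
Proof. by rewrite size_polyDl size_polyXn // size_polyN ltnS size_unit_binomial. Qed.

Lemma mk_monic_modulus u :
  mk_monic ('X^n - unit_binomial u) = 'X^n - unit_binomial u.
Proof.
rewrite /mk_monic size_modulus ltnS (leq_trans k_gt0 (ltnW k_lt_n)) /=.
rewrite monicE lead_coefDl ?lead_coefXn ?eqxx //.
by rewrite size_polyXn size_polyN ltnS size_unit_binomial.
Qed.

Lemma BsetP a : Bset k a <-> exists u, a = unit_binomial u.
Proof.
split=> [[b1 [b0 [b1_unit b0_unit ->]]] | [u ->]].
  by exists (FinRing.Unit b1_unit, FinRing.Unit b0_unit).
by exists (val u.1), (val u.2); split=> //; exact: valP.
Qed.

Definition exp_pair i j (alpha : U) : U * U := (alpha ^+ i, alpha ^+ j)%g.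

(** The factor alpha^n of the leading term also comes out of the others: alpha^(n-k) v1 alpha^k =
    alpha^n v1 and u2 = alpha^n v2. *)
Lemma comp_modulus u v (alpha : U) :
    (u = exp_pair (n - k) n alpha * v)%g ->
  ('X^n - unit_binomial u) \Po (val alpha *: 'X) =
    val alpha ^+ n *: ('X^n - unit_binomial v).
Proof.
move=> ->; rewrite comp_polyB comp_polyD comp_polyZ !comp_Xn_poly comp_polyC.
rewrite !exprZn scalerBr scalerDr !scalerA /= FinRing.val_unitX.
rewrite -[_ *: (_)%:P]mul_polyC -polyCM -[FinRing.uval alpha]/(val alpha).
rewrite mulrAC -exprD (subnK (ltnW k_lt_n)).
by rewrite -[FinRing.uval (alpha ^+ n)%g]/(val (alpha ^+ n)%g) FinRing.val_unitX.
Qed.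

Lemma in_qpoly_modulus u :
  in_qpoly ('X^n - unit_binomial u) ('X^n - unit_binomial u) = 0.
Proof. by rewrite -[X in in_qpoly _ X]mk_monic_modulus in_qpoly_mk_monic. Qed.

Lemma in_qpoly_comp_modulus u v (alpha : U) :
    (u = exp_pair (n - k) n alpha * v)%g ->
  in_qpoly ('X^n - unit_binomial v)
    (mk_monic ('X^n - unit_binomial u) \Po (val alpha *: 'X)) = 0.
Proof.
move/comp_modulus; rewrite mk_monic_modulus => ->.
by rewrite in_qpolyZ in_qpoly_modulus scaler0.
Qed.

Lemma exp_pairM i j : {morph exp_pair i j : alpha beta / (alpha * beta)%g}.
Proof.
have comU (alpha beta : U) : commute alpha beta by apply: val_inj; exact: mulrC.
by move=> alpha beta; congr pair; rewrite expgMn.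
Qed.

Lemma exp_pairV i j alpha : exp_pair i j alpha^-1%g = (exp_pair i j alpha)^-1%g.
Proof. by congr pair; rewrite expgVn. Qed.

Lemma n_equivP u v :
  n_equiv n (unit_binomial u) (unit_binomial v) <->
  exists alpha : U, u = (exp_pair (n - k) n alpha * v)%g.
Proof.
split=> [[alpha alpha_unit [phi _ phiE]] | [alpha uE]].
  exists (FinRing.Unit alpha_unit); set beta := FinRing.Unit _.
  have := phiE ('X^n - unit_binomial u); rewrite in_qpoly_modulus raddf0.
  (* By [comp_modulus], substituting alpha x in x^n - u(x) gives alpha^n (x^n - w(x)); the goal
     becomes w = v. *)
  set w := ((exp_pair (n - k) n beta)^-1 * u)%g.
  rewrite -[alpha]/(val beta) (@comp_modulus u w beta) ?mulKVg // in_qpolyZ.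
  move=> /esym/(congr1 (GRing.scale (val beta ^+ n)^-1)).
  rewrite scalerA mulVr ?unitrX ?scale1r ?scaler0 // => in_w.
  (* Both moduli are monic of degree n, so their difference has degree below n and is its own
     remainder: it vanishes in the quotient only if it is zero. *)
  have : in_qpoly ('X^n - unit_binomial v) (unit_binomial v - unit_binomial w) = 0.
    have -> : unit_binomial v - unit_binomial w =
        ('X^n - unit_binomial w) - ('X^n - unit_binomial v).
      by rewrite opprB [RHS]addrC subrKA.
    by rewrite raddfB /= in_w in_qpoly_modulus subr0.
  move=> /(congr1 (@polyn _ _)); rewrite in_qpoly_small.
    by move/eqP; rewrite subr_eq0 => /eqP/unit_binomial_inj ->; rewrite mulKVg.
  rewrite mk_monic_modulus size_modulus ltnS (leq_trans (size_polyD _ _)) //.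
  by rewrite size_polyN geq_max !size_unit_binomial.
exists (val alpha); first exact: valP.
have vE : (v = exp_pair (n - k) n alpha^-1 * u)%g by rewrite exp_pairV uE mulKg.
have [phi phiE] := qpoly_subst_lrmorphism (in_qpoly_comp_modulus uE).
exists phi => [|f].
  have scale_comp (q : {poly R}) (beta gamma : U) : (beta * gamma = 1)%g ->
      (q \Po (val beta *: 'X)) \Po (val gamma *: 'X) = q.
    move=> beta_gamma; rewrite -comp_polyA comp_polyZ comp_polyX scalerA.
    by rewrite -FinRing.val_unitM beta_gamma scale1r comp_polyXr.
  (* The inverse is substitution of alpha^-1 x, well defined by [vE]. *)
  exists (@qpoly_subst _ ('X^n - unit_binomial v)
    ('X^n - unit_binomial u) (val alpha^-1%g)) => q.
    rewrite phiE (qpoly_subst_in (in_qpoly_comp_modulus vE)).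
    by rewrite scale_comp ?mulgV // in_qpolyK.
  rewrite phiE (qpoly_subst_in (in_qpoly_comp_modulus uE)).
  by rewrite scale_comp ?mulVg // in_qpolyK.
by rewrite phiE (qpoly_subst_in (in_qpoly_comp_modulus uE)).
Qed.

End Polynomials.
Local Open Scope group_scope.

Lemma card_n_classes :
  (@n_classes R n k #=
   `I_(#|[set: U]%SET| * #|'Ldiv_(gcdn n k)([set: U]%SET)|)%N%classic)%card.
Proof.
pose f := Morphism (D := [set: U]) (in2W (@exp_pairM (n - k)%N n)).
pose H := f @* [set: U].
have HP u v : u \in (H :* v) <-> exists alpha : U, u = exp_pair (n - k) n alpha * v.
  rewrite mem_rcoset; split=> [/morphimP[alpha _ _ uE] | [alpha ->]].
    by exists alpha; rewrite -[RHS]/(f alpha * v) -uE mulgKV.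
  by rewrite mulgK; apply/morphimP; exists alpha; rewrite ?inE.
have classE u : n_class n k (unit_binomial u) = image [set` H :* u] unit_binomial.
  apply/seteqP; split=> [b [/BsetP[v ->]] | _ [v uv <-]].
    by move/n_equivP/HP; rewrite rcoset_sym; exists v.
  split; first by apply/BsetP; exists v.
  by apply/n_equivP/HP; rewrite rcoset_sym.
have -> : n_classes n k =
    image [set` rcosets H [set: U * U]] (fun C => image [set` C] unit_binomial).
  apply/seteqP; split=> [_ [a /BsetP[u ->] <-] | _ [C /rcosetsP[u _ ->] <-]].
    exists (H :* u); last by rewrite classE.
    by apply/rcosetsP; exists u; rewrite ?inE.
  by exists (unit_binomial u); [apply/BsetP; exists u | rewrite classE].
(* Since [unit_binomial] is injective, distinct cosets give distinct classes; only the index of [H]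
   remains to be computed. *)
suff <- : #|[set: U * U] : H| =
    (#|[set: U]%SET| * #|'Ldiv_(gcdn n k)([set: U]%SET)|)%N.
  apply: card_eq_image_finset => C D /seteqP[CD DC]; apply/setP=> u.
  have sub (A B : {set U * U}) :
      (image [set` A] unit_binomial `<=` image [set` B] unit_binomial)%classic ->
      u \in A -> u \in B.
    move=> AB uA; have [|v vB /unit_binomial_inj <- //] := AB (unit_binomial u).
    by exists u.
  by apply/idP/idP; exact: sub.
have -> : 'Ldiv_(gcdn n k)([set: U]%SET) = 'ker f.
  (* For k <= n, an order dividing n divides n - k iff it divides k. *)
  apply/setP=> alpha; rewrite !inE /=.
  rewrite -[RHS]/((alpha ^+ (n - k) == 1) && (alpha ^+ n == 1)) -!order_dvdn.
  rewrite dvdn_gcd andbC; case: (boolP (#[alpha] %| n)) => [dvd_n|_].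
    by rewrite !andbT dvdn_subr // ltnW.
  by rewrite !andbF.
have cardUU : #|[set: U * U]%SET| = (#|[set: U]%SET| * #|[set: U]%SET|)%N.
  by rewrite !cardsT card_prod.
have card_kerH : (#|'ker f| * #|H| = #|[set: U]%SET|)%N.
  by rewrite card_morphim finset.setIid Lagrange // subsetIl.
(* Replacing one factor |U| of |U x U| by |ker f| |H| lets |H| cancel. *)
have := Lagrange (finset.subsetT H : H \subset [set: U * U]%G).
rewrite [RHS]cardUU -[X in (_ = X * _)%N]card_kerH mulnC [RHS]mulnAC => /eqP.
by rewrite eqn_pmul2r ?cardG_gt0 // [RHS]mulnC => /eqP.
Qed.

End Classes.

Theorem theorem5 (R : finComUnitRingType) (M : {set R}) (p r s J : nat)
    (m : J.-tuple nat) (n k : nat)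
    (R_chain : is_finite_chain_ring R)
    (M_max : is_maximal_ideal M)
    (p_prime : prime p)
    (M_residue : residue_card M = (p ^ r)%N)
    (M_nilp : nilpotency_index M s)
    (J_gt0 : (0 < J)%N)
    (m_sorted : sorted leq m)
    (m_sum : (\sum_(j < J) tnth m j)%N = (r * (s - 1))%N)
    (R_units : units_decomposition R p r m)
    (k_gt0 : (0 < k)%N) (k_lt_n : (k < n)%N) :
  (@n_classes R n k #=
    `I_(p ^ (r * (s - 1)) * (p ^ r - 1) *
        \sum_(0 <= l < (omega p m n k).+1)
          \sum_(u <- divisors (gcdn (gcdn n k) (p ^ r - 1)))
            num_ord p m l u)%N%classic)%card.
Proof.
have r_gt0 : (0 < r)%N.
  by have := residue_card_gt1 M_max; rewrite M_residue; case: (r).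
have d_gt0 : (0 < gcdn n k)%N by rewrite gcdn_gt0 k_gt0 orbT.
suff -> : (p ^ (r * (s - 1)) * (p ^ r - 1) *
      \sum_(0 <= l < (omega p m n k).+1)
        \sum_(u <- divisors (gcdn (gcdn n k) (p ^ r - 1))) num_ord p m l u =
    #|[set: {unit R}]%SET| * #|('Ldiv_(gcdn n k)([set: {unit R}]%SET))%g|)%N.
  exact: card_n_classes.
rewrite (card_units p_prime r_gt0 R_units) m_sum.
rewrite (card_Ldiv_units p_prime r_gt0 R_units d_gt0) exchange_big /=.
(* For fixed u the sum over l is Phi(u) [num_exp] at [omega]; summing Phi(u) over the divisors then
   yields the gcd with p^r - 1. *)
congr muln; under eq_bigr => u _ do rewrite sum_num_ord ?geq_minr //.
rewrite -big_distrl /= sum_totient_divisors; last by rewrite gcdn_gt0 d_gt0.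
by rewrite num_exp_last // mulnC [gcdn (p ^ r - 1) _]gcdnC.
Qed.
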